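(* Let $n\ge 1$. In every $2$-coloring of the edges of the ordered complete graph on $[n]$ there exists (i) a monochromatic non-crossing spanning tree; (ii) a monochromatic non-nested spanning tree; (iii) a monochromatic non-separated spanning tree.
   Context: The ordered complete graph on $[n]=\{1,\dots,n\}$ is the complete graph with vertex set $[n]$, taken with its natural ordering; edges are written $(i,j)$ with $i<j$. A $2$-coloring is an arbitrary assignment of one of two colors to each edge; a subgraph is monochromatic if all its edges have the same color. Two edges are independent if they share no vertex. Independent edges $(a,b)$ and $(c,d)$ are crossing if $a<c<b<d$ or $c<a<d<b$; nested if $a<c<d<b$ or $c<a<b<d$; separated if $a<b<c<d$ or $c<d<a<b$. A subgraph is non-crossing (resp. non-nested, non-separated) if it contains no two independent edges that are crossing (resp. nested, separated). A spanning tree is a subgraph that is a tree with vertex set $[n]$. *)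

(* Defs.v *)
From mathcomp Require Import all_boot.

Set Implicit Arguments.
Unset Strict Implicit.
Unset Printing Implicit Defensive.

(* The vertex set [n] = {1, ..., n} is represented by 'I_n, that is shifted to
   {0, ..., n-1}; only the order of the vertices matters.  A subgraph with
   vertex set [n] is given by its edge set. *)
Definition edge (n : nat) : Type := {e : 'I_n * 'I_n | e.1 < e.2}.

Definition src (n : nat) (e : edge n) : 'I_n := (val e).1.
Definition tgt (n : nat) (e : edge n) : 'I_n := (val e).2.

Definition coloring (n : nat) : Type := edge n -> bool.

Definition monochromatic (n : nat) (c : coloring n) (T : {set edge n}) : Prop :=
  exists col : bool, forall e, e \in T -> c e = col.

Definition independent (n : nat) (e f : edge n) : bool :=
  [&& src e != src f, src e != tgt f, tgt e != src f & tgt e != tgt f].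

Definition crossing (n : nat) (e f : edge n) : bool :=
  (src e < src f < tgt e) && (tgt e < tgt f) ||
  (src f < src e < tgt f) && (tgt f < tgt e).

Definition nested (n : nat) (e f : edge n) : bool :=
  (src e < src f < tgt f) && (tgt f < tgt e) ||
  (src f < src e < tgt e) && (tgt e < tgt f).

Definition separated (n : nat) (e f : edge n) : bool :=
  (src e < tgt e < src f) && (src f < tgt f) ||
  (src f < tgt f < src e) && (src e < tgt e).

Definition avoids (n : nat) (r : rel (edge n)) (T : {set edge n}) : Prop :=
  forall e f, e \in T -> f \in T -> independent e f -> ~~ r e f.

Definition non_crossing (n : nat) (T : {set edge n}) : Prop :=
  avoids (@crossing n) T.
Definition non_nested (n : nat) (T : {set edge n}) : Prop :=
  avoids (@nested n) T.
Definition non_separated (n : nat) (T : {set edge n}) : Prop :=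
  avoids (@separated n) T.

Definition adj (n : nat) (T : {set edge n}) : rel 'I_n :=
  [rel x y | [exists e in T, (val e == (x, y)) || (val e == (y, x))]].

Definition connected (n : nat) (T : {set edge n}) : Prop :=
  forall x y, connect (adj T) x y.

(* [ucycle] also accepts the degenerate sequences [::] and [:: x; y], which
   are not graph cycles. *)
Definition acyclic (n : nat) (T : {set edge n}) : Prop :=
  forall p : seq 'I_n, 2 < size p -> ~ ucycle (adj T) p.

Definition spanning_tree (n : nat) (T : {set edge n}) : Prop :=
  connected T /\ acyclic T.

(* Main.v *)
(* It suffices to find connected monochromatic graphs avoiding the given
   pattern, since a minimal connected subgraph is a spanning tree.
   (i) If all edges (i-1,i) have the same color they form a non-crossing path.
   Otherwise some (i-1,i) and (i,i+1) differ in color: remove i, apply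
   induction, and attach i by the edge of the right color, which crosses nothing.
   (ii) Let (0,1) be blue and let e be the least red neighbor of 0 (if there is
   none, 0 is the center of a blue star).  Apply induction to the vertices
   1, 2, ..., after recoloring blue all (1,j) with j < e.  In a red solution
   every right endpoint is at least e, so (0,e) can be added.  In a blue
   solution replace (1,j) by (0,j) for all j < e, and add (0,1).
   (iii) The edges whose closed interval contains v are pairwise non-separated.
   If for no v these edges contain a connected monochromatic spanning graph,
   then by induction on v, for each color, some x >= v is joined in that color
   to all l < v; this is absurd when v = n. *)
Require Import Defs.
From Stdlib Require Import Relation_Operators Operators_Properties.
From mathcomp Require Import all_boot zify.

Set Implicit Arguments.
Unset Strict Implicit.
Unset Printing Implicit Defensive.

(** * Spanning trees as minimal connected edge sets *)

Lemma adjC n (T : {set edge n}) : symmetric (adj T).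
Proof.
by move=> x y; apply/existsP/existsP => -[e He]; exists e; rewrite orbC.
Qed.

Lemma adj_setD1 n (T : {set edge n}) (e : edge n) (u v : 'I_n) :
  adj T u v -> val e != (u, v) -> val e != (v, u) -> adj (T :\ e) u v.
Proof.
case/existsP=> g /andP[gT Hg] N1 N2; apply/existsP; exists g.
rewrite !inE gT Hg !andbT; apply/negP => /eqP E; subst g.
by rewrite (negbTE N1) (negbTE N2) in Hg.
Qed.

(** Each step leaves a vertex of [z :: q], which is neither [x] nor [y], so no step uses [e]. *)
Lemma path_avoiding_edge n (T : {set edge n}) (e : edge n) (x y z : 'I_n) q :
  (val e == (x, y)) || (val e == (y, x)) ->
  x \notin z :: q -> y \notin z :: q -> path (adj T) z (rcons q x) ->
  path (adj (T :\ e)) z (rcons q x).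
Proof.
move=> He; elim: q z => [|w q IH] z.
  rewrite !inE /= !andbT => Nx Ny Hzx; apply: adj_setD1 => //.
    by case/orP: He => /eqP->; rewrite xpair_eqE negb_and ?Nx ?Ny.
  by case/orP: He => /eqP->; rewrite xpair_eqE negb_and ?Nx ?Ny ?orbT.
rewrite in_cons negb_or => /andP[Nx Nx'].
rewrite in_cons negb_or => /andP[Ny Ny'] /= /andP[Hzw Hp].
apply/andP; split; last exact: IH.
apply: adj_setD1 => //.
  by case/orP: He => /eqP->; rewrite xpair_eqE negb_and ?Nx ?Ny.
by case/orP: He => /eqP->; rewrite xpair_eqE negb_and ?Nx ?Ny ?orbT.
Qed.

Lemma connected_setD1 n (T : {set edge n}) (e : edge n) :
  connected T -> connect (adj (T :\ e)) (src e) (tgt e) -> connected (T :\ e).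
Proof.
move=> cT ce x y; have sym := sym_connect_sym (adjC (T :\ e)).
have sub : subrel (adj T) (connect (adj (T :\ e))).
  move=> u v; have [E _|N1] := eqVneq (val e) (u, v).
    by move: ce; rewrite /src /tgt E.
  have [E _|N2] := eqVneq (val e) (v, u).
    by move: ce; rewrite sym /src /tgt E.
  by move=> uv; apply/connect1/adj_setD1.
exact: connect_sub sub _ _ (cT x y).
Qed.

Lemma connected_spanning_tree n (T : {set edge n}) :
  connected T -> exists2 T' : {set edge n}, T' \subset T & spanning_tree T'.
Proof.
move=> cT; pose P (S : {set edge n}) := [forall x, forall y, connect (adj S) x y].
have PP S : reflect (connected S) (P S).
  by apply: (iffP forallP) => H x; [exact/forallP | apply/forallP].
have [T' /minsetP[/PP cT' minT'] subT] := minset_exists (introT (PP T) cT).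
(* On a cycle [x, y, z, ...] the remaining edges still join the ends of the edge [e] between [x] and
   [y], so deleting [e] would contradict minimality. *)
exists T' => //; split=> // -[|x [|y [|z q]]] // _ /andP[].
rewrite /cycle [path _ _ _]/= => /and3P[/existsP[e /andP[eT He]] yz pz].
rewrite [uniq _]/= -/(uniq (z :: q)).
rewrite (in_cons y _ x) negb_or => /and3P[/andP[xy xq] yq _].
have Dp : path (adj (T' :\ e)) z (rcons q x).
  exact: (path_avoiding_edge He).
have Dyz : adj (T' :\ e) y z.
  have [zx zy] : z != x /\ z != y.
    by move: xq yq; rewrite !inE !negb_or ![z == _]eq_sym => /andP[-> _] /andP[-> _].
  by apply: adj_setD1 => //; case/orP: He => /eqP->;
    rewrite xpair_eqE negb_and ?(eq_sym y z) ?(eq_sym x z) ?zx ?zy ?xy ?orbT.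
have cyx : connect (adj (T' :\ e)) y x.
  apply: (connect_trans (connect1 Dyz)); apply/connectP.
  by exists (rcons q x); rewrite ?last_rcons.
have cD : connected (T' :\ e).
  apply: connected_setD1 => //; rewrite /src /tgt.
  case/orP: He => /eqP-> //=.
  by rewrite (sym_connect_sym (adjC _)).
have := minT' _ (introT (PP _) cD) (subD1set _ _).
by move=> E; rewrite -E !inE eqxx in eT.
Qed.

(** * Connected graphs on natural numbers *)

(** Vertices are plain numbers so that inductions can delete and shift them. The closure is
    symmetric because edges are stored only as pairs [a < b]. *)
Definition joined (G : rel nat) : nat -> nat -> Prop :=
  clos_refl_sym_trans nat (fun a b => G a b).

Lemma joined_edge (G : rel nat) a b : G a b -> joined G a b.
Proof. exact: rst_step. Qed.

Lemma joined_sym (G : rel nat) a b : joined G a b -> joined G b a.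
Proof. exact: rst_sym. Qed.

Lemma joined_trans (G : rel nat) a b c :
  joined G a b -> joined G b c -> joined G a c.
Proof. exact: rst_trans. Qed.

Lemma joined_map (G G' : rel nat) (h : nat -> nat) :
  (forall a b, G' a b -> joined G (h a) (h b)) ->
  forall a b, joined G' a b -> joined G (h a) (h b).
Proof.
move=> H a b; elim=> [x y /H //|x|x y _ /joined_sym //|x y z _ Hxy _].
  exact: rst_refl.
exact: joined_trans.
Qed.

Lemma joined_neighbor (G : rel nat) a b :
  joined G a b -> a <> b -> exists z, G a z \/ G z a.
Proof. by move=> /(clos_rst_rst1n _ _ _ _) []// y z Hy _ _; exists y. Qed.

(* A coloring of the complete graph on {0, ..., n-1} is a function f, relevant
   only at pairs a < b < n; bad a b c d describes the forbidden position of two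
   edges (a,b) and (c,d). *)
Definition mono_connected (n : nat) (f : nat -> nat -> bool)
    (bad : nat -> nat -> nat -> nat -> bool) : Prop :=
  exists (col : bool) (G : rel nat),
    [/\ forall a b, G a b -> [/\ a < b, b < n & f a b = col],
        forall x y, x < n -> y < n -> joined G x y
      & forall a b c d, G a b -> G c d -> ~~ bad a b c d].

Lemma joined_root (G : rel nat) n r :
  (forall x, x < n -> joined G x r) ->
  forall x y, x < n -> y < n -> joined G x y.
Proof. by move=> H x y /H xr /H /joined_sym; apply: joined_trans. Qed.

Definition color_of n (c : coloring n.+1) (a b : nat) : bool :=
  if insub (inord a, inord b) is Some e then c e else false.

Lemma color_ofE n (c : coloring n.+1) (e : edge n.+1) :
  color_of c (src e) (tgt e) = c e.
Proof.
rewrite /color_of !inord_val /src /tgt -surjective_pairing.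
by rewrite valK.
Qed.

(** Passing to a spanning tree keeps the color and the avoidance. [bad] may describe a single order
    of the two edges, since [mono_connected] excludes it for all ordered pairs. *)
Lemma mono_connected_tree n (c : coloring n.+1)
    (bad : nat -> nat -> nat -> nat -> bool) (r : rel (edge n.+1)) :
  (forall e f, r e f -> bad (src e) (tgt e) (src f) (tgt f) \/
                        bad (src f) (tgt f) (src e) (tgt e)) ->
  mono_connected n.+1 (color_of c) bad ->
  exists T : {set edge n.+1},
    [/\ spanning_tree T, monochromatic c T & avoids r T].
Proof.
move=> Hr [col [G [Gcol Gconn Gbad]]].
pose S : {set edge n.+1} := [set e | G (src e) (tgt e)].
have cS : connected S.
  move=> x y; rewrite -(inord_val x) -(inord_val y).
  elim: (Gconn x y (ltn_ord x) (ltn_ord y)).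
  - move=> a b Gab; have [ab bn _] := Gcol _ _ Gab.
    have lt : ((inord a : 'I_n.+1, inord b : 'I_n.+1).1 <
               (inord a : 'I_n.+1, inord b : 'I_n.+1).2).
      by rewrite /= !inordK // (ltn_trans ab).
    apply: connect1; apply/existsP.
    exists (exist _ (inord a, inord b) lt : edge n.+1).
    by rewrite inE /src /tgt /= !inordK ?Gab ?eqxx // (ltn_trans ab).
  - by move=> a; apply: connect0.
  - by move=> a b _; rewrite (sym_connect_sym (adjC S)).
  - by move=> a b d _ H1 _; apply: connect_trans.
have [T /subsetP sub tree] := connected_spanning_tree cS.
have GT e : e \in T -> G (src e) (tgt e) by move/sub; rewrite inE.
exists T; split=> //.
  by exists col => e /GT /Gcol[_ _]; rewrite color_ofE.
move=> e f /GT He /GT Hf _; apply/negP => /Hr[].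
  exact/negP/Gbad.
exact/negP/Gbad.
Qed.

Definition cross (a b c d : nat) : bool := [&& a < c, c < b & b < d].
Definition nest (a b c d : nat) : bool := [&& a < c, c < d & d < b].
Definition separate (a b c d : nat) : bool := [&& a < b, b < c & c < d].

(** * Non-crossing graphs *)

Lemma mono_connected_cross n f : mono_connected n.+1 f cross.
Proof.
elim: n f => [|n IH] f.
  exists true, (fun _ _ => false); split=> // x y.
  by rewrite !ltnS !leqn0 => /eqP-> /eqP->; apply: rst_refl.
pose alt i := f i i.+1 != f i.+1 i.+2.
have [/hasP[i]|/hasPn same] := boolP (has alt (iota 0 n)); last first.
  have path_col i : i < n.+1 -> f i i.+1 = f 0 1.
    elim: i => // i IHi; rewrite ltnS => ltin.
    have := same i; rewrite mem_iota /= add0n ltin negbK => /(_ isT)/eqP<-.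
    by apply: IHi; lia.
  exists (f 0 1), (fun a b => (b == a.+1) && (b < n.+2)); split.
  - by move=> a b /andP[/eqP-> Hb]; split; rewrite ?path_col.
  - apply: (joined_root (r := 0)); elim=> [|x IHx] Hx; first exact: rst_refl.
    apply: joined_trans (IHx (ltnW Hx)); apply/joined_sym/joined_edge.
    by rewrite eqxx.
  - by move=> a b c d; rewrite /cross; lia.
rewrite mem_iota add0n /alt => /andP[_ ltin] Hi.
(* The deleted vertex is [i.+1], shared by the two edges of different color; [h] skips it and [u]
   undoes [h]. *)
pose h a := if a <= i then a else a.+1.
pose u a := if a <= i then a else a.-1.
have hK : cancel h u by rewrite /h /u => a; case: (leqP a i); case: ifP; lia.
have [col [G [Gcol Gconn Gbad]]] := IH (fun a b => f (h a) (h b)).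
have [j Hj Hcol] : exists2 j, j = i \/ j = i.+1 & f j j.+1 = col.
  have [E|] := eqVneq (f i i.+1) col; first by exists i; [left|].
  by move=> N; exists i.+1; [right|]; move: Hi N; by case: (f i i.+1); case: (f i.+1 i.+2); case: (col).
pose G1 : rel nat := fun a b => ((a == j) && (b == j.+1)) ||
  [&& a != i.+1, b != i.+1 & G (u a) (u b)].
have uK a : a != i.+1 -> h (u a) = a by rewrite /h /u; case: (leqP a i); case: ifP; lia.
have hG a b : joined G a b -> joined G1 (h a) (h b).
  apply: joined_map => x y Gxy; apply: joined_edge.
  by rewrite /G1 !hK Gxy andbT /h; apply/orP; right; apply/andP; split; case: ifP; lia.
exists col, G1; split.
- move=> a b /orP[/andP[/eqP-> /eqP->]|/and3P[Na Nb /Gcol[]]]; first by split=> //; lia.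
  by rewrite !uK // => + + ->; rewrite /u; do 2 case: ifP; move=> *; split=> //; lia.
- have old x : x < n.+2 -> x != i.+1 -> joined G1 x (h 0).
    by move=> Hx Nx; rewrite -(uK x) //; apply/hG/Gconn => //; rewrite /u; case: ifP; lia.
  have jj : joined G1 j j.+1 by apply: joined_edge; rewrite /G1 !eqxx.
  apply: (joined_root (r := h 0)) => x Hx.
  have [->|/old] := eqVneq x i.+1; last exact.
  case: Hj => E; rewrite E in jj.
    by apply: joined_trans (joined_sym jj) _; apply: old; lia.
  by apply: joined_trans jj _; apply: old; lia.
(* No vertex lies strictly between [j] and [j.+1], and [u] keeps the order of the vertices other
   than [i.+1]. *)
- move=> a b c d /orP[/andP[/eqP-> /eqP->]|/and3P[Na Nb H1]].
    by rewrite /cross; lia.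
  case/orP=> [/andP[/eqP-> /eqP->]|/and3P[Nc Nd H2]]; first by rewrite /cross; lia.
  by have := Gbad _ _ _ _ H1 H2; rewrite /cross /u; repeat case: ifP; lia.
Qed.

(** * Non-nested graphs *)

Lemma mono_connected_nest n f : mono_connected n.+1 f nest.
Proof.
elim: n f => [|n IH] f.
  exists true, (fun _ _ => false); split=> // x y.
  by rewrite !ltnS !leqn0 => /eqP-> /eqP->; apply: rst_refl.
set blue := f 0 1.
have [red|star] := boolP (has (fun j => f 0 j != blue) (iota 1 n.+1)); last first.
  exists blue, (fun a b => [&& a == 0, 0 < b & b < n.+2]); split.
  - move=> a b /and3P[/eqP-> Hb Hb']; split=> //; apply/eqP; apply: contraNT star.
    by move=> N; apply/hasP; exists b => //; rewrite mem_iota; lia.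
  - apply: (joined_root (r := 0)) => -[_|x Hx]; first exact: rst_refl.
    exact/joined_sym/joined_edge.
  - by move=> a b c d; rewrite /nest; lia.
have [e [e_gt1 e_lt e_red e_min]] : exists e,
    [/\ 1 < e, e < n.+2, f 0 e = ~~ blue & forall j, 0 < j < e -> f 0 j = blue].
  have ex : exists j, (0 < j < n.+2) && (f 0 j != blue).
    by case/hasP: red => j; rewrite mem_iota => Hj Nj; exists j; rewrite Nj; lia.
  case: (ex_minnP ex) => e /andP[/andP[e0 en] Ne] mine; exists e; split=> //.
  - by rewrite ltn_neqAle e0 andbT; apply: contraNneq Ne => <-.
  - by move: Ne; case: (f 0 e); case: (blue).
  - move=> j /andP[j0 je]; apply: contraTeq (je) => Nj.
    by rewrite -leqNgt; apply: mine; rewrite j0 Nj andbT; lia.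
(* Vertex [a] of the smaller instance stands for [a.+1], so the recolored edges are the [(1, j)]
   with [j < e]. *)
pose f' (a b : nat) := if (a == 0) && (b.+1 < e) then blue else f a.+1 b.+1.
have [col [G [Gcol Gconn Gbad]]] := IH f'.
have [Ecol|Ecol] : col = ~~ blue \/ col = blue by case: (col); case: (blue); auto.
- have [d Gd] : exists d, G 0 d.
    have n_gt0 : 1 < n.+1 by lia.
    have [z [Gz|/Gcol[]//]] := joined_neighbor (Gconn 0 1 isT n_gt0) (@O_S 0).
    by exists z.
  have Gright0 b : G 0 b -> e <= b.+1.
    move=> G0b; rewrite leqNgt; apply/negP => lt; have [_ _] := Gcol _ _ G0b.
    by rewrite /f' eqxx lt Ecol; case: (blue).
  have Gright a b : G a b -> e <= b.+1.
    (* An edge [(a.+1, b)] with [b.+1 < e] would be nested in [(0, d)], because [e <= d.+1]. *)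
    case: a => [/Gright0 //|a Gab]; have [ab _ _] := Gcol _ _ Gab.
    by have := Gbad _ _ _ _ Gd Gab; have := Gright0 _ Gd; rewrite /nest; lia.
  pose G1 : rel nat := fun a b => ((a == 0) && (b == e)) ||
    [&& 0 < a, 0 < b & G a.-1 b.-1].
  have up a b : joined G a b -> joined G1 a.+1 b.+1.
    by apply: joined_map => x y Gxy; apply: joined_edge; rewrite /G1 Gxy orbT.
  exists col, G1; split.
  + move=> a b /orP[/andP[/eqP-> /eqP->]|]; first by rewrite Ecol; split=> //; lia.
    case: a b => [|a] [|b] //= Gab; have [ab bn <-] := Gcol _ _ Gab; split=> //.
    by rewrite /f' ltnNge (Gright _ _ Gab) andbF.
  + apply: (joined_root (r := e)) => -[_|x Hx]; first by apply: joined_edge; rewrite /G1 !eqxx.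
    by rewrite -(prednK (ltnW e_gt1)); apply/up/Gconn; lia.
  + move=> a b c d'; rewrite /G1 /nest.
    move=> /orP[/andP[/eqP-> /eqP->]|/and3P[a0 b0 Ha]];
      move=> /orP[/andP[/eqP-> /eqP->]|/and3P[c0 d0 Hc]]; try lia.
      by have := Gright _ _ Hc; lia.
    by have := Gbad _ _ _ _ Ha Hc; rewrite /nest; lia.
(* The three cases are the new edge [(0, 1)], the edges [(1, b)] with [b < e] moved to [(0, b)], and
   the edges kept. *)
- pose G1 : rel nat := fun a b => [|| (a == 0) && (b == 1),
    [&& a == 0, 1 < b, b < e & G 0 b.-1] |
    [&& 0 < a, 0 < b, (a != 1) || (e <= b) & G a.-1 b.-1]].
  have j01 : joined G1 0 1 by apply: joined_edge.
  have up a b : joined G a b -> joined G1 a.+1 b.+1.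
    apply: joined_map => x y Gxy; have [xy _ _] := Gcol _ _ Gxy.
    (* A moved edge is replaced by the detour from 1 through 0. *)
    have [/andP[/eqP x0 ye]|N] := boolP ((x == 0) && (y.+1 < e)).
      move: Gxy xy; rewrite x0 => Gxy xy; apply: joined_trans (joined_sym j01) _.
      by apply: joined_edge; rewrite /G1 /= Gxy ye !andbT ltnS xy orbT.
    by apply: joined_edge; rewrite /G1 /= Gxy andbT; lia.
  exists col, G1; split.
  + move=> a b /or3P[/andP[/eqP-> /eqP->]|/and4P[/eqP-> b1 be _]|]; first by [].
      by rewrite Ecol e_min ?be ?andbT; last lia; split=> //; lia.
    case: a b => [|a] [|b] //= /andP[N Gab]; have [ab bn <-] := Gcol _ _ Gab.
    by split=> //; rewrite /f'; case: ifP => //; lia.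
  + apply: (joined_root (r := 1)) => -[_|x Hx]; first exact: j01.
    exact/up/Gconn.
  + move=> a b c d; rewrite /G1 => H1 H2; apply/negP; rewrite /nest => H3.
    (* The inner edge [(c, d)] does not start at 0, so it was kept. If the outer one is a moved
       [(0, b)], then [d < b < e] forces [c != 1], and [(1, b)] already contained [(c, d)] in the
       inductive solution. *)
    have {}H2 : [&& 0 < c, 0 < d, (c != 1) || (e <= d) & G c.-1 d.-1].
      by case/or3P: H2 => //; lia.
    case/and4P: H2 => c0 d0 Nc Gcd.
    case/or3P: H1 => [|/and4P[a0 _ be Gab]|/and4P[a0 b0 _ Gab]]; first lia.
      by have := Gbad _ _ _ _ Gab Gcd; rewrite /nest; lia.
    by have := Gbad _ _ _ _ Gab Gcd; rewrite /nest; lia.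
Qed.

(** * Non-separated graphs *)

(** The graph consists of all edges of color [col] whose closed interval contains [v]. The vertex
    [x] is a hub: those below [v] are adjacent to it, the three alternatives link [v] to it, and
    each vertex above [v] hangs on one of these. *)
Lemma mono_connected_through n f v x col :
  v < n -> v <= x < n -> (forall l, l < v -> f l x = col) ->
  [\/ x = v, v < x /\ f v x = col | exists2 l, l < v & f l v = col] ->
  (forall y, v < y < n -> exists2 l, l <= v & f l y = col) ->
  mono_connected n f separate.
Proof.
move=> vn /andP[vx xn] xcol vcol ycol.
pose G : rel nat := fun a b => [&& a < b, a <= v, v <= b, b < n & f a b == col].
exists col, G; split.
- by move=> a b /and5P[? _ _ ? /eqP].
- have low l : l < v -> joined G l x.
    by move=> lv; apply/joined_edge/and5P; split; rewrite ?xcol //; lia.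
  have vG : joined G v x.
    case: vcol => [->|[vx' E]|[l lv E]]; first exact: rst_refl.
      by apply/joined_edge/and5P; split; rewrite ?E //; lia.
    apply: joined_trans (low l lv); apply/joined_sym/joined_edge/and5P.
    by split; rewrite ?E //; lia.
  apply: (joined_root (r := x)) => y yn.
  case: (ltngtP y v) => [/low //|vy|-> //].
  have [|l lv E] := ycol y; first by rewrite vy.
  apply: (@joined_trans _ _ l); last by case: (ltngtP l v) lv => [/low|//|->].
  by apply/joined_sym/joined_edge/and5P; split; rewrite ?E //; lia.
- move=> a b c d /and5P[_ _ vb _ _] /and5P[_ cv _ _ _]; rewrite /separate; lia.
Qed.

Lemma mono_connected_separate n f : 0 < n -> mono_connected n f separate.
Proof.
move=> n0.
pose Q v := forall col, exists2 x, v <= x < n & forall l, l < v -> f l x = col.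
suff H v : v <= n -> mono_connected n f separate \/ Q v.
  by case: (H n (leqnn n)) => // /(_ true)[x]; lia.
elim: v => [|v IHv] vn; first by right=> col; exists 0.
case: (IHv (ltnW vn)) => [|Qv]; first by left.
(* If the hub [x] does not yield a solution, the last hypothesis of [mono_connected_through] fails,
   and its failure is the vertex [y]. *)
have step col x : v <= x < n -> (forall l, l < v -> f l x = col) ->
    [\/ x = v, v < x /\ f v x = col | exists2 l, l < v & f l v = col] ->
    mono_connected n f separate \/
    exists2 y, v < y < n & forall l, l <= v -> f l y = ~~ col.
  move=> vx xcol vcol.
  have [/hasP[y]|/hasPn none] := boolP (has (fun y =>
      all (fun l => f l y != col) (iota 0 v.+1)) (iota v.+1 (n - v.+1))).
    rewrite mem_iota => Hy /allP ycol; right; exists y; first lia.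
    move=> l lv; have := ycol l; rewrite mem_iota => /(_ lv).
    by case: (f l y); case: (col).
  left; apply: (mono_connected_through vn vx xcol vcol) => y Hy.
  have Hy' : y \in iota v.+1 (n - v.+1) by rewrite mem_iota; lia.
  have /allPn[l] := none y Hy'.
  by rewrite mem_iota negbK => Hl /eqP; exists l.
(* For [v = 0] the hub is [v] itself; otherwise the color of [(0, v)] is chosen, so that 0 links [v]
   to the hub. *)
have [col [x [vx xcol vcol]]] : exists col x, [/\ v <= x < n,
    forall l, l < v -> f l x = col &
    [\/ x = v, v < x /\ f v x = col | exists2 l, l < v & f l v = col]].
  have [v0|v0] := posnP v; first by exists true, v; split; [lia | lia | exact: Or31].
  have [x vx xcol] := Qv (f 0 v).
  by exists (f 0 v), x; split=> //; apply: Or33; exists 0.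
case: (step col x) => // [|[y vy ycol]]; first by left.
(* Since [y] is adjacent to [v] in color [~~ col], it is a hub for that color and yields [z] for
   [col]; [y] and [z] together give [Q v.+1]. *)
case: (step (~~ col) y) => //.
- by lia.
- by move=> l /ltnW/ycol.
- by apply: Or32; rewrite ycol //; split=> //; lia.
- by left.
case=> z vz zcol; right=> col'.
have [->|N] := eqVneq col' col.
  by exists z => // l /zcol; rewrite negbK.
by exists y => // l /ycol ->; move: N; case: (col'); case: (col).
Qed.

Theorem theorem2p1 (n : nat) (hn : 1 <= n) (c : coloring n) :
  [/\ exists T : {set edge n},
        [/\ spanning_tree T, monochromatic c T & non_crossing T],
      exists T : {set edge n},
        [/\ spanning_tree T, monochromatic c T & non_nested T]
    & exists T : {set edge n},
        [/\ spanning_tree T, monochromatic c T & non_separated T]].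
Proof.
case: n hn c => // n _ c; split.
- apply: (mono_connected_tree (bad := cross)) (mono_connected_cross _ _) => e f.
  by rewrite /crossing /cross; lia.
- apply: (mono_connected_tree (bad := nest)) (mono_connected_nest _ _) => e f.
  by rewrite /nested /nest; lia.
- apply: (mono_connected_tree (bad := separate)) (mono_connected_separate _ _) => // e f.
  by rewrite /separated /separate; lia.
Qed.
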